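(* Let $m$ be an odd positive integer not divisible by $3$. If $n=1$ or $n=2$, then there is no generalized bent function $f:\mathbb{Z}_3^n\to\mathbb{Z}_m$.
   Context: A function $f:G\to\mathbb{Z}_m$ on a finite abelian group $G$ is a generalized bent function if $\left|\sum_{x\in G}\zeta_m^{f(x)}\chi(x)\right|^2=|G|$ for every character $\chi$ of $G$, where $\zeta_m$ is a primitive $m$-th root of unity. *)

(* Defs.v *)
From HB Require Import structures.
From mathcomp Require Import all_boot all_order all_algebra.
From mathcomp Require Export reals.
From mathcomp.real_closed Require Export complex.

Set Implicit Arguments.
Unset Strict Implicit.
Unset Printing Implicit Defensive.

Import Order.TTheory GRing.Theory Num.Theory.
Local Open Scope ring_scope.

(* A homomorphism from the additive group G to the multiplicative group of C;
   values are nonzero because chi x * chi (- x) = chi 0 = 1. *)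
Definition is_group_character (C : numClosedFieldType) (G : finZmodType)
    (chi : G -> C) : Prop :=
  chi 0 = 1 /\ {morph chi : x y / x + y >-> x * y}.

(* The integers mod m are represented by their residues 'I_m rather than by
   'Z_m, since the latter is not the trivial group when m = 1.  Here zeta is
   intended to be a primitive m-th root of unity, so that zeta ^+ f x only
   depends on the class of f x mod m. *)
Definition generalized_bent (C : numClosedFieldType) (G : finZmodType)
    (m : nat) (zeta : C) (f : G -> 'I_m) : Prop :=
  forall chi : G -> C, is_group_character chi ->
    `| \sum_(x : G) zeta ^+ f x * chi x | ^+ 2 = #|G|%:R.

(* Main.v *)
(* By Fourier inversion a bent f has zero autocorrelation at every nonzero a,
   so the 3^n numbers zeta^(f x - f (x + a)) form a vanishing sum of m-th roots
   of unity.  Irreducibility of the cyclotomic polynomial shows that their k-th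
   power sums p_k also vanish for every k, of either sign, prime to m.  Since m
   is prime to 6 this covers k = +-1, +-2, +-3, +-4 and k = 3^n.  With
   N = 3^n <= 9 terms, Newton's identities read from both ends then force all
   middle coefficients of prod (X - z_i) to vanish, so this polynomial is
   X^N + c with c <> 0 and p_N = - N c <> 0, a contradiction. *)

Require Import Defs.
From HB Require Import structures.
From mathcomp Require Import all_boot all_order all_algebra.
From mathcomp Require Import reals.
From mathcomp.real_closed Require Import complex.
From mathcomp Require Import algC cyclotomic.
From mathcomp Require Import zify ring.

Set Implicit Arguments.
Unset Strict Implicit.
Unset Printing Implicit Defensive.

Import Order.TTheory GRing.Theory Num.Theory.
Local Open Scope ring_scope.

(** * Power sums and the coefficients of a split polynomial *)

Lemma deriv_prod_XsubC (F : fieldType) (s : seq F) :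
  (\prod_(x <- s) ('X - x%:P))^`() =
  \sum_(x <- s) (\prod_(y <- s) ('X - y%:P)) %/ ('X - x%:P).
Proof.
elim: s => [|x s IHs]; first by rewrite !big_nil derivC.
rewrite !big_cons derivM derivXsubC mul1r IHs mulr_sumr.
rewrite mulKp ?polyXsubC_eq0 //; congr (_ + _).
apply: eq_big_seq => y ys; rewrite divp_mulA //.
by rewrite dvdp_XsubCl root_prod_XsubC.
Qed.

Lemma coef0_divp_XsubC (F : fieldType) (p : {poly F}) (x : F) :
  root p x -> p`_0 = - x * (p %/ ('X - x%:P))`_0.
Proof.
rewrite -dvdp_XsubCl => /divpK <-; rewrite mulpK ?polyXsubC_eq0 //.
by rewrite !mulrBr !coefB !coefMX !coefMC /= sub0r mulNr [x * _]mulrC.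
Qed.

(** Synthetic division: solved upwards, the recurrence brings in negative powers of [x]; solved
    downwards, positive ones. *)
Lemma coefS_divp_XsubC (F : fieldType) (p : {poly F}) (x : F) (k : nat) :
  root p x ->
  p`_k.+1 = (p %/ ('X - x%:P))`_k - x * (p %/ ('X - x%:P))`_k.+1.
Proof.
rewrite -dvdp_XsubCl => /divpK <-; rewrite mulpK ?polyXsubC_eq0 //.
by rewrite !mulrBr !coefB !coefMX !coefMC /= [x * _]mulrC.
Qed.

Lemma power_sums_eq0_nil (F : numFieldType) (s : seq F) :
  0 \notin s ->
  (forall k, (0 < k)%N -> (k.*2 <= size s)%N ->
     \sum_(x <- s) x ^+ k = 0 /\ \sum_(x <- s) x ^- k = 0) ->
  \sum_(x <- s) x ^+ size s = 0 -> s = [::].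
Proof.
move=> s_n0 low_sums top_sum; set N := size s in low_sums top_sum.
pose q : {poly F} := \prod_(x <- s) ('X - x%:P).
have q_root x : x \in s -> root q x by rewrite root_prod_XsubC.
have size_q : size q = N.+1 by rewrite size_prod_XsubC.
have qN : q`_N = 1.
  have := monic_prod_XsubC s xpredT id.
  by rewrite monicE lead_coefE size_q => /eqP.
(* This is the source of Newton's identities: once the quotient coefficients are known as powers of
   [x], the right side becomes a power sum. *)
have coef_q k : q`_k.+1 *+ k.+1 = \sum_(x <- s) (q %/ ('X - x%:P))`_k.
  by rewrite -coef_deriv deriv_prod_XsubC coef_sum.
have size_d x : size (q %/ ('X - x%:P)) = N.
  by rewrite size_divp ?polyXsubC_eq0 // size_XsubC size_q subn1.
(* From the constant term upwards: as long as the coefficients of [q] vanish, each step divides the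
   quotient coefficient by [x], and the negative power sums kill the next coefficient of [q]. *)
have low k : (k.*2 <= N)%N ->
    ((0 < k)%N -> q`_k = 0) /\
    (forall x, x \in s -> (q %/ ('X - x%:P))`_k = - q`_0 * x ^- k.+1).
  elim: k => [_|k IHk le_k].
    split=> // x xs; rewrite (coef0_divp_XsubC (q_root x xs)).
    rewrite !mulNr opprK expr1 mulrAC mulfV ?mul1r //.
    by apply: contraNneq s_n0 => <-.
  have [|_ dk] := IHk; first by lia.
  have qk : q`_k.+1 = 0.
    have := coef_q k; rewrite (eq_big_seq _ dk) -mulr_sumr.
    have [_ ->] := low_sums k.+1 isT le_k.
    by rewrite mulr0 => /eqP; rewrite mulrn_eq0 => /eqP.
  split=> // x xs; have := coefS_divp_XsubC k (q_root x xs).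
  rewrite qk dk // => /esym/eqP; rewrite subr_eq0 => /eqP e.
  have x0 : x != 0 by apply: contraNneq s_n0 => <-.
  by apply: (mulfI x0); rewrite -e mulrCA [x ^+ k.+2]exprS invfM mulVKf.
(* From the leading term downwards, with positive power sums; the bound [k < N] keeps the
   subtractions exact. *)
have high k : (k.*2 <= N)%N -> (k < N)%N ->
    ((0 < k)%N -> q`_(N - k) = 0) /\
    (forall x, x \in s -> (q %/ ('X - x%:P))`_(N - k.+1) = x ^+ k).
  elim: k => [_ N_gt0|k IHk le_k lt_k].
    split=> // x xs; have := coefS_divp_XsubC N.-1 (q_root x xs).
    rewrite prednK // qN subn1 [_`_N]nth_default ?size_d // mulr0 subr0.
    by move=> <-.
  have [||_ dk] := IHk; [by lia | by lia |].
  have e1 : (N - k.+1 = (N - k.+2).+1)%N by lia.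
  have dk' x : x \in s ->
      (q %/ ('X - x%:P))`_(N - k.+2) = q`_(N - k.+1) + x ^+ k.+1.
    move=> xs; have := coefS_divp_XsubC (N - k.+2) (q_root x xs).
    by rewrite -e1 dk // -exprS => ->; rewrite subrK.
  have qk : q`_(N - k.+1) = 0.
    have := coef_q (N - k.+2)%N; rewrite (eq_big_seq _ dk') -e1 big_split /=.
    have [-> _] := low_sums k.+1 isT le_k.
    (* With c the coefficient in question, the identity reads (N - k - 1) c = N c, so (k + 1) c =
       0. *)
    rewrite big_const_seq count_predT iter_addr_0 addr0 -/N.
    rewrite -[X in _ = _ *+ X](subnK (ltnW lt_k)) mulrnDr -[LHS]addr0.
    by move/addrI/esym/eqP; rewrite mulrn_eq0 => /eqP.
  by split=> // x xs; rewrite dk' // qk add0r.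
case: (posnP N) => [/size0nil //|N_gt0].
have mid k : (0 < k < N)%N -> q`_k = 0.
  move=> /andP[k_gt0 lt_k]; case: (leqP k.*2 N) => le_k.
    by have [->] := low k le_k.
  rewrite -(subKn (ltnW lt_k)).
  by have [||-> //] := high (N - k)%N; lia.
(* Now q = X^N + q_0, so summing over its roots gives N q_0 = 0, while q_0 is nonzero because 0 is
   not a root. *)
have : \sum_(x <- s) q.[x] = 0.
  by rewrite big_seq big1 // => x xs; apply/eqP/q_root.
have qE x : q.[x] = q`_0 + x ^+ N.
  rewrite horner_coef size_q big_ord_recr /= qN mul1r; congr (_ + _).
  rewrite (bigD1 (Ordinal N_gt0)) //= expr0 mulr1 big1 ?addr0 // => i i0.
  by rewrite mid ?mul0r // ltn_ord andbT lt0n.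
under eq_bigr do rewrite qE.
rewrite big_split /= top_sum addr0 big_const_seq count_predT iter_addr_0 -/N.
move/eqP; rewrite mulrn_eq0 -horner_coef0 -rootE root_prod_XsubC.
by rewrite (negPf s_n0) orbF => /eqP /size0nil.
Qed.

(** * Conjugate primitive roots of unity *)

Lemma root_Cyclotomic (F : idomainType) (m : nat) (z : F) :
  m.-primitive_root z -> root (map_poly intr 'Phi_m) z.
Proof.
move=> prim_z; have m_gt0 := prim_order_gt0 prim_z.
have Phi_dvd d : (0 < d)%N -> root (map_poly intr 'Phi_d) z -> z ^+ d = 1.
  move=> d_gt0 rz.
  have /(congr1 (map_poly (intr : int -> F))) := prod_Cyclotomic d_gt0.
  rewrite (big_rem d) -?dvdn_divisors //= rmorphM rmorphB rmorph1 /= map_polyXn.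
  move/(congr1 (horner^~ z)); rewrite hornerM (eqP rz) mul0r !hornerE.
  by move/esym/eqP; rewrite subr_eq0 => /eqP.
have /(congr1 (map_poly (intr : int -> F))) := prod_Cyclotomic m_gt0.
rewrite rmorph_prod rmorphB rmorph1 /= map_polyXn.
move/(congr1 (horner^~ z)); rewrite horner_prod !hornerE.
rewrite prim_expr_order // subrr => /eqP; rewrite prodf_seq_eq0 => /hasP[d].
(* A factor Phi_d of X^m - 1 vanishes at [z]; then z^d = 1, which forces m to divide d. *)
rewrite -dvdn_divisors // => d_dvd rz.
have d_gt0 := dvdn_gt0 m_gt0 d_dvd.
suff -> : m = d by [].
apply/eqP; rewrite eqn_dvd d_dvd andbT (prim_order_dvd prim_z).
exact/eqP/Phi_dvd.
Qed.

Lemma prim_root_conjugate (F : numFieldType) (m : nat) (x y : F)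
    (p : {poly rat}) :
  m.-primitive_root x -> m.-primitive_root y ->
  root (map_poly ratr p) x -> root (map_poly ratr p) y.
Proof.
move=> prim_x prim_y px0.
(* Irreducibility of Phi_m is available as minimality over [algC]. It is used at this auxiliary
   root, and carried to [F] through a gcd over the rationals: either Phi_m divides [p], or the two
   are coprime and cannot share the root [x]. *)
have [z prim_z] := C_prim_root_exists (prim_order_gt0 prim_x).
have ratr_intr (K : numFieldType) (r : {poly int}) :
    map_poly (ratr : rat -> K) (map_poly intr r) = map_poly intr r.
  by rewrite -map_poly_comp; apply: eq_map_poly => a; rewrite /= rmorph_int.
have [f [minE f_monic] f_dvd] := minCpolyP z.
have fE : f = map_poly intr 'Phi_m.
  apply: (map_poly_inj (ratr : {rmorphism rat -> algC})) => /=.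
  by rewrite ratr_intr (Cintr_Cyclotomic prim_z) -minCpoly_cyclotomic.
have f_root t : m.-primitive_root t -> root (map_poly (ratr : rat -> F) f) t.
  by move=> prim_t; rewrite fE ratr_intr root_Cyclotomic.
suff /dvdpP[g ->] : f %| p by rewrite rmorphM rootM f_root ?orbT.
have /divpK fg := dvdp_gcdl f p; set d := gcdp f p in fg; set e := f %/ d in fg.
have : root (map_poly (ratr : rat -> algC) f) z by rewrite f_dvd.
rewrite -{1}fg rmorphM rootM !f_dvd => /orP[f_e|f_d]; last first.
  exact: dvdp_trans f_d (dvdp_gcdr _ _).
have f0 : f != 0 by apply: monic_neq0.
have [e0 d0] : e != 0 /\ d != 0.
  by apply/andP; rewrite -negb_or -mulf_eq0 fg.
have size_d : size d = 1%N.
  have /eqp_size : f %= e by rewrite /eqp f_e -fg dvdp_mulr.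
  rewrite -fg size_mul // => eq_size.
  by move: e0 d0; rewrite -!size_poly_gt0; lia.
have : coprimep f p by rewrite coprimep_def size_d.
rewrite -(coprimep_map (ratr : {rmorphism rat -> F})) => /coprimep_root.
by move/(_ _ (f_root x prim_x)); rewrite -rootE px0.
Qed.

(** * Characters of Z_3^n and autocorrelation *)

Lemma norm_unity_root (C : numDomainType) (n : nat) (z : C) :
  (0 < n)%N -> z ^+ n = 1 -> `|z| = 1.
Proof.
by move=> n_gt0 zn; apply/eqP; rewrite -(pexpr_eq1 n_gt0) // -normrX zn normr1.
Qed.

Lemma conj_unity_root (C : numClosedFieldType) (n : nat) (z : C) :
  (0 < n)%N -> z ^+ n = 1 -> z^* = z^-1.
Proof.
move=> n_gt0 zn; rewrite invC_norm (norm_unity_root n_gt0 zn).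
by rewrite expr1n invr1 mul1r.
Qed.

(** A root of X^2 + X + 1 has order dividing 3, and order 1 would give 3 = 0. *)
Lemma cube_root_exists (C : numClosedFieldType) : {w : C | 3.-primitive_root w}.
Proof.
have /closed_rootP/sigW[w] : size ('X^2 + ('X + 1) : {poly C}) != 1%N.
  by rewrite size_polyDl ?size_polyXn // -[1]/(1%:P) size_XaddC.
rewrite rootE !hornerE /= => /eqP w_root; exists w.
have w3 : w ^+ 3 = 1.
  apply/eqP; rewrite -subr_eq0 -(mulr0 (w - 1)) -w_root.
  rewrite subrX1 !big_ord_recr big_ord0 /= add0r expr0 expr1.
  by rewrite addrC [1 + w]addrC addrA.
have [d prim_w d3] := prim_order_exists (isT : (0 < 3)%N) w3.
have : (d == 1%N) || (d == 3%N) by move: d3; rewrite dvdn_divisors // !inE.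
case/orP => /eqP dE; last by rewrite -dE.
have := prim_expr_order prim_w; rewrite dE expr1 => w1.
move: w_root; rewrite w1 expr1n -[1]/(1%:R) -!natrD => /eqP.
by rewrite pnatr_eq0.
Qed.

Section Characters.
Variables (C : numClosedFieldType) (w : C).
Hypothesis prim_w : 3.-primitive_root w.
Variable n : nat.
Implicit Types x y a : 'rV['Z_3]_n.

Definition dot_char y x : C := w ^+ ((x *m y^T) 0 0 : 'Z_3).

Let expD (a b : 'Z_3) : w ^+ (a + b)%R = w ^+ a * w ^+ b.
Proof. by rewrite /= (prim_expr_mod prim_w) exprD. Qed.

Lemma dot_char0 y : dot_char y 0 = 1.
Proof. by rewrite /dot_char mul0mx mxE expr0. Qed.

Lemma dot_charC x y : dot_char y x = dot_char x y.
Proof. by rewrite /dot_char -[y in RHS]trmxK -trmx_mul [in RHS]mxE. Qed.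

Lemma dot_charD y : {morph dot_char y : x x' / x + x' >-> x * x'}.
Proof. by move=> x x'; rewrite /dot_char mulmxDl mxE expD. Qed.

Lemma dot_char_is_character y : is_group_character (dot_char y).
Proof. by split; [apply: dot_char0 | apply: dot_charD]. Qed.

Lemma conj_dot_char y x : (dot_char y x)^* = dot_char y (- x).
Proof.
have w3 : dot_char y x ^+ 3 = 1.
  by rewrite /dot_char exprAC (prim_expr_order prim_w) expr1n.
rewrite (conj_unity_root _ w3) //.
have e : dot_char y x * dot_char y (- x) = 1.
  by rewrite -dot_charD subrr dot_char0.
have nz : dot_char y x != 0.
  by apply: contra_eq_neq e => ->; rewrite mul0r eq_sym oner_eq0.
by apply: (mulfI nz); rewrite e mulfV.
Qed.

Lemma sum_dot_char x :
  \sum_y dot_char y x = if x == 0 then #|{: 'rV['Z_3]_n}|%:R else 0.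
Proof.
have [->|/rV0Pn[i xi]] := eqVneq x 0.
  by under eq_bigr do rewrite dot_char0; rewrite sumr_const.
(* Translating [y] by this basis vector multiplies the sum by w^(x_i), which is not 1, so the sum
   vanishes. *)
pose y0 : 'rV['Z_3]_n := delta_mx 0 i.
have y0x : dot_char y0 x != 1.
  rewrite /dot_char trmx_delta -colE mxE -(prim_order_dvd prim_w).
  by rewrite /dvdn modn_small // (ltn_ord (x 0 i)).
apply/eqP; move: y0x; rewrite -subr_eq0 => /mulfI/mulrI_eq0 <-.
rewrite mulrBl mul1r subr_eq0 mulr_sumr [X in _ == X](reindex_inj (addrI y0)).
by apply/eqP/eq_bigr => y _; rewrite ![dot_char _ x]dot_charC dot_charD.
Qed.

End Characters.

(** The sum [S] is computed twice. Bentness makes the squared moduli constant, so orthogonality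
    gives 0; expanding them instead, orthogonality keeps only the pairs with x' = x + a. *)
Lemma bent_autocorrelation (C : numClosedFieldType) (m n : nat) (zeta : C)
    (f : 'rV['Z_3]_n -> 'I_m) (a : 'rV['Z_3]_n) :
  zeta ^+ m = 1 -> generalized_bent zeta f -> a != 0 ->
  \sum_x zeta ^+ f x * zeta ^- f (x + a) = 0.
Proof.
move=> zeta_m bent a0; have [w prim_w] := cube_root_exists C.
have m_gt0 : (0 < m)%N := leq_ltn_trans (leq0n _) (ltn_ord (f 0)).
have cardG : #|{: 'rV['Z_3]_n}|%:R != 0 :> C.
  by rewrite pnatr_eq0 -lt0n; apply/card_gt0P; exists 0.
pose S := \sum_y dot_char w y a * `|\sum_x zeta ^+ f x * dot_char w y x| ^+ 2.
have S0 : S = 0.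
  rewrite /S.
  under eq_bigr => y _ do rewrite (bent _ (dot_char_is_character prim_w y)).
  by rewrite -mulr_suml sum_dot_char // (negPf a0) mul0r.
suff /eqP : #|{: 'rV['Z_3]_n}|%:R *
    (\sum_x zeta ^+ f x * zeta ^- f (x + a)) = S.
  by rewrite S0 mulf_eq0 (negPf cardG) => /eqP.
transitivity (\sum_x \sum_x' \sum_y
   zeta ^+ f x * zeta ^- f x' * dot_char w y (x - x' + a)).
  rewrite mulr_sumr; apply: eq_bigr => x _.
  under eq_bigr do rewrite -mulr_sumr sum_dot_char //.
  rewrite (bigD1 (x + a)) //= opprD addrA subrr add0r addNr eqxx big1 ?addr0.
    by rewrite mulrC.
  move=> x' ne; rewrite ifF ?mulr0 //; apply: contraNF ne.
  by rewrite addrAC subr_eq0 eq_sym.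
under eq_bigr do rewrite exchange_big.
rewrite exchange_big; apply: eq_bigr => y _ /=.
rewrite normCK rmorph_sum mulr_suml mulr_sumr; apply: eq_bigr => x _.
rewrite !mulr_sumr; apply: eq_bigr => x' _.
rewrite rmorphM rmorphXn /= conj_dot_char // (conj_unity_root m_gt0 zeta_m).
rewrite !dot_charD // exprVn.
by ring.
Qed.

(** * Vanishing sums of roots of unity and the conclusion *)

Lemma no_vanishing_sum (F : numFieldType) (m : nat) (z : F) (s : seq nat) :
  m.-primitive_root z ->
  (forall k, (0 < k)%N -> (k.*2 <= size s)%N -> coprime k m) ->
  coprime (size s) m ->
  \sum_(e <- s) z ^+ e = 0 -> s = [::].
Proof.
move=> prim_z co_low co_size sum0.
have m_gt0 := prim_order_gt0 prim_z.
have sum_eval (t : F) :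
    (map_poly ratr (\sum_(e <- s) 'X^e)).[t] = \sum_(e <- s) t ^+ e.
  rewrite rmorph_sum horner_sum /=.
  by apply: eq_bigr => e _; rewrite map_polyXn hornerXn.
(* The sum is a rational polynomial evaluated at [z], so its vanishing passes to the conjugate
   z^k. *)
have conj_sum k : coprime k m -> \sum_(e <- s) z ^+ e ^+ k = 0.
  move=> co_k; under eq_bigr do rewrite exprAC.
  rewrite -sum_eval; apply/eqP; rewrite -rootE.
  apply: (prim_root_conjugate prim_z); first by rewrite prim_root_exp_coprime.
  by rewrite rootE sum_eval sum0.
(* Since m - 1 is -1 modulo m and prime to m, negative power sums reduce to [conj_sum]. *)
have zN e k : z ^+ e ^- k = z ^+ e ^+ (k * m.-1).
  have nz : z ^+ e ^+ k != 0.
    by rewrite !expf_neq0 // (prim_root_eq0 prim_z) -lt0n.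
  apply: (mulfI nz); rewrite mulfV // -exprD -mulnS prednK // mulnC exprM.
  by rewrite [z ^+ e ^+ m]exprAC (prim_expr_order prim_z) !expr1n.
have: [seq z ^+ e | e <- s] = [::].
  apply: power_sums_eq0_nil; rewrite ?size_map.
  - apply/mapP => -[e _ /esym/eqP]; rewrite expf_eq0 (prim_root_eq0 prim_z).
    by rewrite [m == _]gtn_eqF // andbF.
  - move=> k k_gt0 le_k; have co_k := co_low k k_gt0 le_k.
    rewrite !big_map conj_sum //; split=> //.
    under eq_bigr do rewrite zN.
    by rewrite conj_sum // coprimeMl co_k coprimePn.
  - by rewrite big_map conj_sum.
by move/(congr1 size); rewrite size_map => /size0nil.
Qed.

Theorem corollary3p2 (R : realType) (m n : nat) (zeta : R[i])
    (m_gt0 : (0 < m)%N) (m_odd : odd m) (m_n3 : ~~ (3 %| m)%N)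
    (hzeta : m.-primitive_root zeta) (hn : n = 1%N \/ n = 2%N) :
  ~ exists f : 'rV['Z_3]_n -> 'I_m, generalized_bent zeta f.
Proof.
case=> f bent.
have n_gt0 : (0 < n)%N by case: hn => ->.
pose a : 'rV['Z_3]_n := delta_mx 0 (Ordinal n_gt0).
have a0 : a != 0 by apply/rV0Pn; exists (Ordinal n_gt0); rewrite mxE !eqxx.
(* Natural representatives of f(x) - f(x + a) modulo m. *)
pose s := [seq (f x + (m - f (x + a)%R))%N | x <- enum {: 'rV['Z_3]_n}].
have size_s : size s = (3 ^ n)%N.
  by rewrite size_map -cardE card_mx card_ord mul1n.
have size_bound : (3 ^ n <= 9)%N by case: hn => ->.
have co2 : coprime 2 m by rewrite coprime2n.
have co3 : coprime 3 m by rewrite prime_coprime.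
suff : s = [::] by move/(congr1 size)/eqP; rewrite size_s expn_eq0.
apply: (no_vanishing_sum hzeta); rewrite ?size_s.
(* The bound on n enters here: 1, 2, 3 and 4 have no prime factors besides 2 and 3. *)
- move=> k k_gt0 le_k; have : (k <= 4)%N by lia.
  case: k k_gt0 {le_k} => [|[|[|[|[|]]]]] // _ _; first exact: coprime1n.
  by rewrite (coprimeXl 2 co2).
- exact: coprimeXl.
rewrite big_map big_enum /=.
rewrite -[RHS](bent_autocorrelation (prim_expr_order hzeta) bent a0).
apply: eq_bigr => x _; rewrite exprD exprB ?(prim_expr_order hzeta) ?mul1r //.
  exact: ltnW.
by rewrite unitfE (prim_root_eq0 hzeta) -lt0n.
Qed.
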